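(* The condition number $\kappa$ of the map $g(A,b)=L^{\top}(A^{\top}\Sigma_{pq}A)^{-1}A^{\top}\Sigma_{pq}b$ at $(A,b)$ (componentwise norm on the data, norm $\|\cdot\|_G$ on the solution space $G=\mathbb R^k$) is $$\kappa=\max_{\|u\|_{G*}=1}\big\|[\,V D_A\ \ W D_b\,]^{\top}L u\big\|_1=\big\|[\,VD_A\ \ WD_b\,]^{\top}L\big\|_{G*,1},$$ where $$V=(A^{\top}\Sigma_{pq}A)^{-1}\otimes(\Sigma_{pq}r)^{\top}-x^{\top}\otimes W,\qquad W=(A^{\top}\Sigma_{pq}A)^{-1}A^{\top}\Sigma_{pq}.$$
   Context: Let $m\ge n$, $p+q=m$, $\Sigma_{pq}=\begin{pmatrix} I_p&0\\0&-I_q\end{pmatrix}$, $A=(a_{ij})\in\mathbb R^{m\times n}$, $b\in\mathbb R^m$, with $A^{\top}\Sigma_{pq}A$ positive definite (standing assumption). Let $x=(A^{\top}\Sigma_{pq}A)^{-1}A^{\top}\Sigma_{pq}b$ be the solution of the indefinite least squares problem $\min_x(b-Ax)^{\top}\Sigma_{pq}(b-Ax)$, and $r=b-Ax$. Let $L\in\mathbb R^{n\times k}$, $k\le n$, be a fixed matrix, and $g(A,b)=L^{\top}(A^{\top}\Sigma_{pq}A)^{-1}A^{\top}\Sigma_{pq}b\in\mathbb R^k$, which is Fréchet differentiable near $(A,b)$, with derivative $g'(A,b)$. On the data space the componentwise norm relative to $(A,b)$ is used: $\|(\Delta A,\Delta b)\|_c=\min\{\omega\ge0:\ |\Delta a_{ij}|\le\omega|a_{ij}|,\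 |\Delta b_i|\le\omega|b_i|\ \text{for all } i,j\}$ (equal to $+\infty$ if no such $\omega$ exists). Given a norm $\|\cdot\|_G$ on $G=\mathbb R^k$, the condition number is $\kappa=\max_{\|(\Delta A,\Delta b)\|_c=1}\|g'(A,b)\cdot(\Delta A,\Delta b)\|_G$. $\|\cdot\|_{G*}$ denotes the dual norm of $\|\cdot\|_G$ with respect to the canonical inner product, $\|u\|_{G*}=\max_{v\ne0}\langle u,v\rangle/\|v\|_G$, and $\|\cdot\|_{G*,1}$ is the operator norm for maps from $(\mathbb R^k,\|\cdot\|_{G*})$ to a space with the $1$-norm. $\mathrm{vec}$ stacks the columns of a matrix, $D_A=\mathrm{diag}(\mathrm{vec}(A))$, $D_b=\mathrm{diag}(b)$, and $\otimes$ is the Kronecker product. *)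

(* Defs.v *)
From HB Require Import structures.
From mathcomp Require Import all_boot all_order all_algebra.
From mathcomp Require Import all_classical all_reals all_analysis.
From mathcomp Require Import mxtens.

Set Implicit Arguments.
Unset Strict Implicit.
Unset Printing Implicit Defensive.

Import Order.TTheory GRing.Theory Num.Theory.
Import numFieldNormedType.Exports.

Local Open Scope classical_set_scope.
Local Open Scope ring_scope.

Definition is_max (R : realType) (S : set R) (x : R) : Prop := S x /\ ubound S x.

Definition posdefmx (R : realType) (n : nat) (M : 'M[R]_n) : Prop :=
  M^T = M /\ forall x : 'cV[R]_n, x != 0 -> 0 < (x^T *m M *m x) 0 0.

Record is_norm (R : realType) (k : nat) (N : 'cV[R]_k -> R) : Prop := IsNorm {
  is_norm_eq0 : forall v, N v = 0 -> v = 0 ;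
  is_normZ : forall a v, N (a *: v) = `|a| * N v ;
  is_normD : forall u v, N (u + v) <= N u + N v }.

Definition dotv (R : realType) (k : nat) (u v : 'cV[R]_k) : R :=
  \sum_(i < k) u i 0 * v i 0.

Definition norm1 (R : realType) (k : nat) (v : 'cV[R]_k) : R :=
  \sum_(i < k) `|v i 0|.

Definition dual_norm (R : realType) (k : nat) (N : 'cV[R]_k -> R)
    (u : 'cV[R]_k) : R :=
  sup [set dotv u v / N v | v in [set v | v != 0]].

(* Operator norm of M, from the norm N on the source to the 1-norm. *)
Definition opnorm1 (R : realType) (k l : nat) (N : 'cV[R]_k -> R)
    (M : 'M[R]_(l, k)) : R :=
  sup [set norm1 (M *m u) / N u | u in [set u | u != 0]].

(* vec stacks the columns, whereas mxvec is row-major. *)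
Definition vec (R : realType) (m n : nat) (A : 'M[R]_(m, n)) : 'cV[R]_(n * m) :=
  (mxvec A^T)^T.

Definition Sigma (R : realType) (p q : nat) : 'M[R]_(p + q) :=
  block_mx 1%:M 0 0 (- 1%:M).

Section IndefiniteLeastSquares.
Variables (R : realType) (p q n : nat).
Local Notation m := (p + q)%N.
Implicit Types (A : 'M[R]_(m, n)) (b : 'cV[R]_m).

Definition ils_gram A : 'M[R]_n := A^T *m Sigma R p q *m A.

Definition ils_W A : 'M[R]_(n, m) := invmx (ils_gram A) *m A^T *m Sigma R p q.

Definition ils_sol A b : 'cV[R]_n := ils_W A *m b.

Definition ils_res A b : 'cV[R]_m := b - A *m ils_sol A b.

(* The casts identify n * 1 and 1 * n with n. *)
Definition ils_V A b : 'M[R]_(n, n * m) :=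
  castmx (muln1 n, erefl (n * m)%N)
    (invmx (ils_gram A) *t (Sigma R p q *m ils_res A b)^T)
  - castmx (mul1n n, erefl (n * m)%N) ((ils_sol A b)^T *t ils_W A).

(* The block row [V D_A  W D_b]. *)
Definition ils_VW A b : 'M[R]_(n, n * m + m) :=
  row_mx (ils_V A b *m diag_mx (vec A)^T) (ils_W A *m diag_mx b^T).

Definition ils_map (k : nat) (L : 'M[R]_(n, k)) (z : 'M[R]_(m, n) * 'cV[R]_m)
    : 'cV[R]_k :=
  L^T *m ils_sol z.1 z.2.

(* Extended real: the infimum of the empty set is +oo. *)
Definition comp_norm (z dz : 'M[R]_(m, n) * 'cV[R]_m) : \bar R :=
  ereal_inf [set w%:E | w in [set w : R | [/\ 0 <= w,
    forall i j, `|dz.1 i j| <= w * `|z.1 i j| &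
    forall i, `|dz.2 i 0| <= w * `|z.2 i 0| ]]].

Definition cond_values (k : nat) (N : 'cV[R]_k -> R)
    (f : 'M[R]_(m, n) * 'cV[R]_m -> 'cV[R]_k) (z : 'M[R]_(m, n) * 'cV[R]_m)
    : set R :=
  [set N ('d f z dz) | dz in [set dz | comp_norm z dz = 1%:E]].

Definition cond_number (k : nat) (N : 'cV[R]_k -> R)
    (f : 'M[R]_(m, n) * 'cV[R]_m -> 'cV[R]_k) (z : 'M[R]_(m, n) * 'cV[R]_m) : R :=
  sup (cond_values N f z).

End IndefiniteLeastSquares.

Lemma index_allpairs_pair (S T : eqType) (s : seq S) (t : seq T) x y :
  x \in s -> y \in t ->
  index (x, y) [seq (x', y') | x' <- s, y' <- t] = (index x s * size t + index y t)%N.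
Proof.
elim: s => // a s IHs xs yt /=; rewrite index_cat size_map.
have [ax|nax] := eqVneq a x.
  have -> : (x, y) \in [seq (a, y') | y' <- t].
    by apply/mapP; exists y; rewrite ?ax.
  rewrite mul0n add0n ax.
  have inj : injective (fun y' : T => (x, y')) by move=> ? ? [].
  exact: (index_map inj).
have -> : ((x, y) \in [seq (a, y') | y' <- t]) = false.
  by apply/mapP => -[y' _ [E _]]; rewrite E eqxx in nax.
by rewrite IHs //; [rewrite mulSn addnA | move: xs; rewrite inE eq_sym (negPf nax)].
Qed.

Lemma mxvec_index_tens m n (i : 'I_m) (j : 'I_n) :
  mxvec_index i j = mxtens_index (i, j).
Proof.
apply: val_inj => /=; set k := enum_rank _.
have <- : index (i, j) (enum {: 'I_m * 'I_n}) = k.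
  by rewrite -[X in index X _](nth_enum_rank (i, j)) index_uniq ?enum_uniq // -cardE.
rewrite (_ : enum _ = prod_enum 'I_m 'I_n); last by rewrite enumT unlock.
by rewrite index_allpairs_pair ?mem_enum // !index_enum_ord size_enum_ord.
Qed.

(* vec is indexed compatibly with *t: entry (i, j) of A sits at j * m + i. *)
Lemma vecE (R : realType) m n (A : 'M[R]_(m, n)) i j :
  vec A (mxtens_index (j, i)) 0 = A i j.
Proof. by rewrite -mxvec_index_tens !mxE mxvecE mxE. Qed.

(* Main.v *)
(* Write M for the transpose of [V D_A  W D_b] times L.  A perturbation of
   componentwise norm 1 is the entrywise product of the data with a vector e of
   the unit cube, and the derivative of g maps it to M^T e.  Hence kappa is the
   maximum over the cube of the norm of M^T e, while for each u the maximum over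
   the cube of <M u, e> is the 1-norm of M u.  Finite-dimensional Hahn-Banach
   (every vector has a norming functional of dual norm 1) exchanges the two
   maxima.
   The derivative comes without differentiating the matrix inverse: the normal
   equations express the error of the linearization exactly as a quadratic
   term plus a term (increment of the Gram matrix) * (increment of x). *)
From HB Require Import structures.
Require Import Defs.
From mathcomp Require Import all_boot all_order all_algebra.
From mathcomp Require Import all_classical all_reals all_analysis.
From mathcomp Require Import mxtens ring lra.
Set Implicit Arguments.
Unset Strict Implicit.
Unset Printing Implicit Defensive.
Import Order.TTheory GRing.Theory Num.Theory.
Import numFieldNormedType.Exports.
Local Open Scope classical_set_scope.
Local Open Scope ring_scope.

(** * Norms on column vectors and their duals *)

Definition sublinear (R : realType) (V : lmodType R) (p : V -> R) : Prop :=
  (forall x y, p (x + y) <= p x + p y) /\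
  (forall c x, 0 <= c -> p (c *: x) = c * p x).

(** * Flattening sublinear functionals into linear ones *)

Section HahnBanach.
Variables (R : realType) (V : lmodType R).
Implicit Types (p q : V -> R).

Lemma sublinear0 p : sublinear p -> p 0 = 0.
Proof. by case=> _ /(_ 0 0 (lexx 0)); rewrite scale0r mul0r. Qed.

Lemma sublinear_oppr_ge p x : sublinear p -> - p (- x) <= p x.
Proof.
move=> ps; have := ps.1 x (- x); rewrite subrr sublinear0 // => h.
by rewrite -subr_ge0 opprK.
Qed.

(* The witness is [q x = inf_(t >= 0) (p (x + t *: a) - t * p a)].  It is linear
   along [a], and keeps every direction along which [p] was already linear, so
   that iterating over a basis yields a linear form. *)
Lemma sublinear_flatten p a : sublinear p -> exists q,
  [/\ sublinear q, forall x, q x <= p x & q (- a) = - p a].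
Proof.
move=> ps.
pose E x := [set p (x + t *: a) - t * p a | t in [set t : R | 0 <= t]].
have Ex0 x : E x (p x) by exists 0 => //=; rewrite scale0r mul0r addr0 subr0.
have Elb x : lbound (E x) (- p (- x)).
  move=> _ [t /= t0 <-].
  have := ps.1 (x + t *: a) (- x); rewrite addrAC subrr add0r ps.2 //; lra.
have Ehas x : has_inf (E x) by split; [exists (p x)|exists (- p (- x))].
have qle x y : E x y -> inf (E x) <= y by apply: ge_inf; case: (Ehas x).
have qge x y : lbound (E x) y -> y <= inf (E x).
  by apply: lb_le_inf; case: (Ehas x).
exists (fun x => inf (E x)); split.
- split=> [x y|c x].
    apply/ler_addgt0Pr => e e0.
    have [_ [s /= s0 <-] hs] := inf_adherent (divr_gt0 e0 (ltr0Sn R 1)) (Ehas x).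
    have [_ [t /= t0 <-] ht] := inf_adherent (divr_gt0 e0 (ltr0Sn R 1)) (Ehas y).
    have h1 : inf (E (x + y)) <= p ((x + y) + (s + t) *: a) - (s + t) * p a.
      by apply: qle; exists (s + t) => //=; apply: addr_ge0.
    have h2 := ps.1 (x + s *: a) (y + t *: a).
    rewrite addrACA -scalerDl in h2; lra.
  rewrite le_eqVlt => /predU1P[<-|c0].
    rewrite scale0r mul0r; apply/eqP; rewrite eq_le; apply/andP; split.
      by apply: qle; have := Ex0 0; rewrite sublinear0.
    by apply: qge; have := Elb 0; rewrite oppr0 sublinear0 // oppr0.
  (* The competitor with parameter t at [c *: x] is c times the competitor with parameter t / c at
     x. *)
  have scale t : 0 <= t ->
      p (c *: x + t *: a) - t * p a = c * (p (x + (t / c) *: a) - t / c * p a).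
    move=> t0; have ct : c * (t / c) = t by rewrite mulrC divfK ?gt_eqF.
    by rewrite mulrBr -(ps.2 c) ?(ltW c0) // scalerDr scalerA ct mulrA ct.
  apply/eqP; rewrite eq_le; apply/andP; split.
    rewrite mulrC -ler_pdivrMr //; apply: qge => _ [t /= t0 <-].
    rewrite ler_pdivrMr // [_ * c]mulrC; apply: qle; exists (c * t) => /=.
      by apply: mulr_ge0 => //; exact: ltW.
    rewrite scale ?mulr_ge0 ?(ltW c0) //; by rewrite [c * t]mulrC mulfK ?gt_eqF.
  apply: qge => _ [t /= t0 <-]; rewrite scale // ler_pM2l //.
  by apply: qle; exists (t / c) => //=; rewrite divr_ge0 // ltW.
- by move=> x; apply: qle.
(* The general lower bound at [- a] is already [- p a], and t = 1 attains it. *)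
- apply/eqP; rewrite eq_le; apply/andP; split; last first.
    by apply: qge; have := Elb (- a); rewrite opprK.
  by apply: qle; exists 1; rewrite //= scale1r addNr sublinear0 // mul1r sub0r.
Qed.

(** Later flattenings do not spoil a direction already treated: if q' is sublinear and q' <= q <= p
    with q(-a) = -p(a), then q'(-a) <= -p(a) <= -q'(a), and sublinearity gives the reverse
    inequality. *)
Lemma sublinear_flatten_seq (s : seq V) p : sublinear p -> exists q,
  [/\ sublinear q, forall x, q x <= p x & forall a, a \in s -> q (- a) = - q a].
Proof.
elim: s p => [|a s IHs] p ps; first by exists p.
have [q [qs qp qa]] := sublinear_flatten a ps.
have [q' [q's q'q q'a]] := IHs q qs.
exists q'; split=> // [x|x]; first exact: le_trans (q'q x) (qp x).
rewrite inE => /predU1P[->|]; last exact: q'a.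
have := sublinear_oppr_ge a q's; have := q'q (- a); have := q'q a; have := qp a.
rewrite qa; lra.
Qed.

End HahnBanach.

Lemma bounded_increments_continuous (R : realType) (V W : normedModType R)
    (f : V -> W) K : 0 <= K -> (forall x y, `|f x - f y| <= K * `|x - y|) ->
  continuous f.
Proof.
move=> K0 fK x; apply/cvgrPdist_le => e e0.
have K1 : 0 < K + 1 by rewrite ltr_wpDl.
apply/nbhs_normP; exists (e / (K + 1)) => /=; first exact: divr_gt0.
move=> y; rewrite /ball_ /= ltr_pdivlMr // => xy.
by rewrite (le_trans (fK _ _)) // (le_trans _ (ltW xy)) // mulrC ler_wpM2l // lerDl.
Qed.

(** * The entrywise maximum norm of matrices *)

Section MatrixNorm.
Variable R : realType.

Lemma mxE_le_norm m n (M : 'M[R]_(m, n)) i j : `|M i j| <= `|M|.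
Proof.
rewrite [leRHS]/Num.Def.normr /= mx_normrE.
exact: (le_bigmax _ (fun ij : 'I_m * 'I_n => `|M ij.1 ij.2|) (i, j)).
Qed.

Lemma mx_norm_le m n (M : 'M[R]_(m, n)) c :
  0 <= c -> (forall i j, `|M i j| <= c) -> `|M| <= c.
Proof.
move=> c0 Mc; rewrite [leLHS]/Num.Def.normr /= mx_normrE.
by apply: bigmax_le => // -[i j] _ /=.
Qed.

Lemma mx_norm_tr m n (M : 'M[R]_(m, n)) : `|M^T| = `|M|.
Proof.
apply/eqP; rewrite eq_le; apply/andP; split; apply: mx_norm_le => // i j.
  by rewrite mxE mxE_le_norm.
by have := mxE_le_norm M^T j i; rewrite mxE.
Qed.

(** The maximum norm is not submultiplicative: an entry of the product sums n terms, whence the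
    factor n. *)
Lemma mx_norm_mul m n r (M : 'M[R]_(m, n)) (P : 'M[R]_(n, r)) :
  `|M *m P| <= n%:R * `|M| * `|P|.
Proof.
apply: mx_norm_le => [|i j]; first by rewrite !mulr_ge0.
rewrite mxE (le_trans (ler_norm_sum _ _ _)) // -mulrA mulr_natl.
rewrite -[X in _ *+ X]card_ord -sumr_const; apply: ler_sum => l _.
by rewrite normrM ler_pM ?mxE_le_norm.
Qed.

Lemma mx_norm_prod_le m n r (M : 'M[R]_(m, n)) (P : 'M[R]_(n, r)) a c :
  `|M| <= a -> `|P| <= c -> `|M *m P| <= n%:R * a * c.
Proof.
move=> Ma Pc; rewrite (le_trans (mx_norm_mul _ _)) // ler_pM ?mulr_ge0 //.
by rewrite ler_wpM2l.
Qed.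

End MatrixNorm.

(** * Norming functionals and equivalence of norms *)

Section DualNorm.
Variables (R : realType) (k : nat) (N : 'cV[R]_k -> R) (N_norm : is_norm N).
Implicit Types (u v : 'cV[R]_k).

Lemma is_norm_sublinear : sublinear N.
Proof.
by split=> [|c x c0]; [exact: is_normD N_norm|rewrite is_normZ // ger0_norm].
Qed.

Lemma is_normN v : N (- v) = N v.
Proof. by rewrite -scaleN1r is_normZ // normrN1 mul1r. Qed.

Lemma is_norm0 : N 0 = 0.
Proof. exact: sublinear0 is_norm_sublinear. Qed.

Lemma is_norm_ge0 v : 0 <= N v.
Proof. by have := sublinear_oppr_ge v is_norm_sublinear; rewrite is_normN; lra. Qed.

Lemma is_norm_gt0 v : v != 0 -> 0 < N v.
Proof.
move=> v0; rewrite lt_neqAle is_norm_ge0 andbT eq_sym.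
by apply: contraNN v0 => /eqP /(is_norm_eq0 N_norm) ->.
Qed.

Lemma is_norm_sum (I : Type) (r : seq I) (F : I -> 'cV[R]_k) :
  N (\sum_(i <- r) F i) <= \sum_(i <- r) N (F i).
Proof.
elim: r => [|i r IHr]; first by rewrite !big_nil is_norm0.
by rewrite !big_cons (le_trans (is_normD N_norm _ _)) // lerD2l.
Qed.

Lemma cV_sum_delta v : v = \sum_(i < k) v i 0 *: delta_mx i 0.
Proof. by rewrite [LHS]matrix_sum_delta; apply: eq_bigr => i _; rewrite big_ord1. Qed.

Lemma dotv_mulmx u v : dotv u v = (u^T *m v) 0 0.
Proof. by rewrite mxE; apply: eq_bigr => i _; rewrite mxE. Qed.

(** Flattening N along v0 first fixes the value at [- v0] to [- N v0]; flattening along the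
    canonical basis then makes the functional linear, and its values on that basis are the
    coordinates of u. *)
Lemma norming_functional v0 :
  exists u, dotv u v0 = N v0 /\ forall v, dotv u v <= N v.
Proof.
have [p [ps pN pv0]] := sublinear_flatten v0 is_norm_sublinear.
have [q [qs qp qodd]] := sublinear_flatten_seq [seq delta_mx i 0 | i <- enum 'I_k] ps.
pose u : 'cV[R]_k := \col_i q (delta_mx i 0).
have qZ c i : q (c *: delta_mx i 0) = c * q (delta_mx i 0).
  have [c0|c0] := leP 0 c; first by rewrite qs.2.
  rewrite -[c *: _]opprK -scalerN -scaleNr qs.2 ?oppr_ge0 ?(ltW c0) //.
  by rewrite qodd ?mulrNN //; apply/mapP; exists i; rewrite ?mem_enum.
have q_le v : q v <= dotv u v.
  rewrite {1}[v]cV_sum_delta /dotv.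
  elim/big_rec2 : _ => [|i x y _ xy]; first by rewrite sublinear0.
  by rewrite (le_trans (qs.1 _ _)) // qZ mxE mulrC lerD2l.
have dotN v : dotv u (- v) = - dotv u v.
  by rewrite !dotv_mulmx mulmxN mxE.
(* A sublinear functional lying below a linear form coincides with it, by comparing the two at
   [- v]. *)
have uq v : dotv u v = q v.
  apply/eqP; rewrite eq_le q_le andbT.
  rewrite -lerN2 -dotN (le_trans _ (q_le _)) //.
  by have := sublinear_oppr_ge (- v) qs; rewrite opprK; lra.
have uN v : dotv u v <= N v by rewrite uq (le_trans (qp v)).
exists u; split=> //; apply/eqP; rewrite eq_le uN /= uq.
by have := sublinear_oppr_ge v0 qs; have := qp (- v0); rewrite pv0; lra.
Qed.

Lemma is_norm_le_mx_norm : exists2 K, 0 <= K & forall v, N v <= K * `|v|.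
Proof.
exists (\sum_(i < k) N (delta_mx i 0)).
  by apply: sumr_ge0 => i _; exact: is_norm_ge0.
move=> v; rewrite {1}[v]cV_sum_delta (le_trans (is_norm_sum _ _)) //.
rewrite mulr_suml; apply: ler_sum => i _.
by rewrite is_normZ // mulrC ler_wpM2l ?is_norm_ge0 ?mxE_le_norm.
Qed.

(** By compactness N has a positive minimum on the unit sphere of the maximum norm, and C is its
    inverse. N is transported to row vectors, where [EVT_min_rV] applies. *)
Lemma mx_norm_le_is_norm : exists2 C, 0 <= C & forall v, `|v| <= C * N v.
Proof.
have [K K0 NK] := is_norm_le_mx_norm.
pose f (w : 'rV[R]_k) := N w^T.
have fcont : continuous f.
  have NB x y : N x - N y <= N (x - y).
    by rewrite lerBlDr (le_trans _ (is_normD N_norm _ _)) // subrK.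
  apply: (bounded_increments_continuous K0) => w z.
  rewrite -(mx_norm_tr (w - z)) (le_trans _ (NK _)) // linearB /= ler_norml NB andbT.
  by rewrite lerNl opprB (le_trans (NB _ _)) // -is_normN opprB.
pose S := [set w : 'rV[R]_k | `|w| = 1].
(* The sphere is empty only in dimension 0, where every vector vanishes. *)
have [[w0 Sw0]|S0] := pselect (S !=set0); last first.
  exists 0 => // v; rewrite mul0r; case: (eqVneq v 0) => [->|v0]; first by rewrite normr0.
  exfalso; apply: S0; exists (`|v|^-1 *: v^T).
  by rewrite /S /= normrZ normfV normr_id mx_norm_tr mulVf ?normr_eq0.
have cS : compact S.
  apply: bounded_closed_compact.
    by exists 1; split=> // x x1 w /= ->; exact: ltW.
  apply: (@closed_comp _ _ (fun w : 'rV[R]_k => `|w|) [set 1]).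
    by move=> w _; exact: norm_continuous.
  exact: closed_eq.
have [c cS' cmin] := EVT_min_rV (ex_intro _ w0 Sw0) cS (continuous_subspaceT fcont).
have fc0 : 0 < f c.
  apply: is_norm_gt0; rewrite -normr_gt0 mx_norm_tr; move: cS'; rewrite inE => ->.
  exact: ltr01.
exists (f c)^-1; first by rewrite invr_ge0 ltW.
move=> v; case: (eqVneq v 0) => [->|v0].
  by rewrite normr0 is_norm0 mulr0.
rewrite mulrC ler_pdivlMr //.
have nv0 : 0 < `|v| by rewrite normr_gt0.
have : f c <= f (`|v|^-1 *: v^T).
  apply: cmin; rewrite inE /S /=.
  by rewrite normrZ normfV normr_id mx_norm_tr mulVf ?normr_eq0.
rewrite /f linearZ /= trmxK is_normZ // normfV normr_id mulrC ler_pdivlMr //.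
by rewrite mulrC.
Qed.

End DualNorm.

(** * Attained dual norms and the exchange of the two maxima *)

Section DualNormMax.
Variables (R : realType) (k : nat) (N : 'cV[R]_k -> R) (N_norm : is_norm N).
Hypothesis k_gt0 : (0 < k)%N.
Implicit Types (u v : 'cV[R]_k).

(** Ensures that the suprema over nonzero vectors run over nonempty sets. *)
Lemma cV_nonzero : exists v : 'cV[R]_k, v != 0.
Proof.
exists (const_mx 1); apply/eqP => /colP /(_ (Ordinal k_gt0)); rewrite !mxE.
by apply/eqP; rewrite oner_eq0.
Qed.

Lemma dual_norm_has_ubound u :
  has_ubound [set dotv u v / N v | v in [set v | v != 0]].
Proof.
have [C C0 CN] := mx_norm_le_is_norm N_norm.
exists (\sum_(i < k) `|u i 0| * C) => _ [v /= v0 <-].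
rewrite ler_pdivrMr ?is_norm_gt0 // /dotv mulr_suml; apply: ler_sum => i _.
rewrite (le_trans (ler_norm _)) // normrM -mulrA ler_wpM2l //.
exact: le_trans (mxE_le_norm _ _ _) (CN v).
Qed.

Lemma dotv_le_dual_norm u v : dotv u v <= dual_norm N u * N v.
Proof.
have [->|v0] := eqVneq v 0.
  by rewrite (is_norm0 N_norm) mulr0 /dotv big1 // => i _; rewrite mxE mulr0.
rewrite -ler_pdivrMr ?is_norm_gt0 //.
by apply: ub_le_sup; [exact: dual_norm_has_ubound|exists v].
Qed.

Lemma dual_norm_gt0 u : u != 0 -> 0 < dual_norm N u.
Proof.
move=> u0; rewrite -(pmulr_lgt0 _ (is_norm_gt0 N_norm u0)).
apply: lt_le_trans (dotv_le_dual_norm u u).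
have [i ui] : exists i, u i 0 != 0.
  apply: contrapT => h; case/negP: u0; apply/eqP/colP => i; rewrite mxE.
  by apply/eqP; apply: contra_notT h => ui; exists i.
rewrite /dotv (bigD1 i) //= ltr_pwDl ?sumr_ge0 // => [|j _].
  by rewrite -expr2 exprn_even_gt0.
by rewrite -expr2 sqr_ge0.
Qed.

Lemma dual_norm_ge0 u : 0 <= dual_norm N u.
Proof.
have [->|/dual_norm_gt0/ltW//] := eqVneq u 0; have [v v0] := cV_nonzero.
rewrite -(pmulr_lge0 _ (is_norm_gt0 N_norm v0)).
apply: le_trans (dotv_le_dual_norm 0 v).
by rewrite /dotv big1 // => i _; rewrite mxE mul0r.
Qed.

Lemma dual_norm_le u c : (forall v, dotv u v <= c * N v) -> dual_norm N u <= c.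
Proof.
move=> uc; have [v v0] := cV_nonzero.
apply: ge_sup; first by exists (dotv u v / N v), v.
by move=> _ [w /= w0 <-]; rewrite ler_pdivrMr ?is_norm_gt0.
Qed.

(** A norming functional of a nonzero v has dual norm at most 1 by domination, and at least 1 by its
    value at v. For v = 0 the functional of any nonzero vector serves. *)
Lemma dual_norm1_norming v : exists2 u, dual_norm N u = 1 & dotv u v = N v.
Proof.
wlog v0 : v / v != 0.
  move=> hyp; have [->|] := eqVneq v 0; last exact: hyp.
  have [w /hyp [u u1 _]] := cV_nonzero; exists u => //.
  by rewrite (is_norm0 N_norm) /dotv big1 // => i _; rewrite mxE mulr0.
have [u [uv uN]] := norming_functional N_norm v; exists u => //.
apply/eqP; rewrite eq_le dual_norm_le => [|w]; last by rewrite mul1r.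
by rewrite -(ler_pM2r (is_norm_gt0 N_norm v0)) mul1r -{1}uv dotv_le_dual_norm.
Qed.

Lemma dotv_mulmxl l (M : 'M[R]_(l, k)) u (e : 'cV[R]_l) :
  dotv (M *m u) e = dotv u (M^T *m e).
Proof. by rewrite !dotv_mulmx trmx_mul mulmxA. Qed.

Lemma dotv_le_norm1 l (w e : 'cV[R]_l) :
  (forall i, `|e i 0| <= 1) -> dotv w e <= norm1 w.
Proof.
move=> e1; apply: ler_sum => i _.
by rewrite (le_trans (ler_norm _)) // normrM ler_piMr.
Qed.

(* Both maxima are attained at sign vectors: the linear form [dotv (M *m u)]
   is maximal on the unit cube at the signs of [M *m u], and a norming
   functional of [M^T *m s] turns the value at a sign vector [s] into a bound
   from below. *)
Lemma max_at_sign_vector l (M : 'M[R]_(l, k)) : exists s : 'cV[R]_l,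
  [/\ forall i, `|s i 0| = 1,
      forall e : 'cV[R]_l, (forall i, `|e i 0| <= 1) -> N (M^T *m e) <= N (M^T *m s),
      is_max [set norm1 (M *m u) | u in [set u | dual_norm N u = 1]]
        (N (M^T *m s))
    & N (M^T *m s) = opnorm1 (dual_norm N) M].
Proof.
(* Sign vectors are encoded by a finite type, so a best one exists without compactness. *)
pose sg (f : {ffun 'I_l -> bool}) : 'cV[R]_l := \col_i (-1) ^+ f i.
have sg1 f i : `|sg f i 0| = 1 by rewrite mxE normr_sign.
pose F f := N (M^T *m sg f).
have [f0 F_max] : exists f0, forall f, F f <= F f0.
  have [f0 _ Fmax] := @Order.TotalTheory.arg_maxP _ R _ [ffun=> true] xpredT F isT.
  by exists f0 => f; apply: Fmax.
have norm1_le u : norm1 (M *m u) <= F f0 * dual_norm N u.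
  have -> : norm1 (M *m u) = dotv (M *m u) (sg [ffun i => (M *m u) i 0 < 0]).
    by apply: eq_bigr => i _; rewrite [sg _ _ _]mxE ffunE mulrC -normrEsign.
  rewrite dotv_mulmxl (le_trans (dotv_le_dual_norm _ _)) // mulrC.
  by apply: ler_wpM2r; [exact: dual_norm_ge0|exact: F_max].
have [u0 u01 u0M] := dual_norm1_norming (M^T *m sg f0).
have norm1_u0 : norm1 (M *m u0) = F f0.
  apply/eqP; rewrite eq_le; apply/andP; split.
    by have := norm1_le u0; rewrite u01 mulr1.
  by rewrite /F -u0M -dotv_mulmxl dotv_le_norm1 // => i; rewrite sg1.
(* [opnorm1] ranges over nonzero vectors; the dual norm of 0 is at most 0, so u0 is admissible. *)
have u0n0 : u0 != 0.
  apply/eqP => u00; suff : 1 <= 0 :> R by rewrite ler10.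
  rewrite -u01; apply: dual_norm_le => v.
  by rewrite u00 mul0r /dotv big1 // => i _; rewrite mxE mul0r.
exists (sg f0); split=> //.
- move=> e e1; have [u u1 uM] := dual_norm1_norming (M^T *m e).
  rewrite -uM -dotv_mulmxl (le_trans (dotv_le_norm1 _ e1)) //.
  by have := norm1_le u; rewrite u1 mulr1.
- split; first by exists u0.
  by move=> _ [u /= u1 <-]; have := norm1_le u; rewrite u1 mulr1.
- have ub : ubound [set norm1 (M *m u) / dual_norm N u | u in [set u | u != 0]] (F f0).
    by move=> _ [u /= u_n0 <-]; rewrite ler_pdivrMr ?dual_norm_gt0.
  apply/eqP; rewrite eq_le; apply/andP; split.
    apply: ub_le_sup; first by exists (F f0).
    by exists u0; rewrite // norm1_u0 u01 divr1.
  by apply: ge_sup => //; exists (norm1 (M *m u0) / dual_norm N u0), u0.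
Qed.

End DualNormMax.

(** * The derivative of the solution map *)

(** A quadratic error is little-o of h, and the bound on df makes it continuous, so uniqueness of
    the differential applies. *)
Lemma diff_quadratic_error (R : realType) (V W : normedModType R)
    (f df : V -> W) (x : V) (K C d : R) :
  linear df -> 0 <= K -> (forall h, `|df h| <= K * `|h|) ->
  0 < d -> 0 <= C ->
  (forall h, `|h| <= d -> `|f (x + h) - f x - df h| <= C * `|h| ^+ 2) ->
  'd f x = df :> (V -> W).
Proof.
move=> dfl K0 dfK d0 C0 fC.
pose dfL : {linear V -> W} := HB.pack df (GRing.isLinear.Build _ _ _ _ df dfl).
have /= := @diff_unique R V W f dfL x; apply.
  apply: (bounded_increments_continuous K0) => y z.
  by rewrite -[dfL y - dfL z]raddfB; exact: dfK.
apply/eqaddoP => e e0; apply/nbhs_normP.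
have C1 : 0 < C + 1 by rewrite ltr_wpDl.
(* This radius forces C |h| <= e; C + 1 replaces C, which may be 0. *)
exists (Num.min d (e / (C + 1))) => /=; first by rewrite lt_min d0 divr_gt0.
move=> h; rewrite /ball_ /= sub0r normrN lt_min ltr_pdivlMr // => /andP[hd he].
rewrite -[X in `|X|]/(f (h + x) - (f x + df h)) [h + x]addrC opprD addrA (le_trans (fC h (ltW hd))) //.
rewrite expr2 mulrA ler_wpM2r //; apply: le_trans (ltW he).
by rewrite mulrC ler_wpM2l // lerDl.
Qed.

Lemma prod_norm_fst (R : realType) (V W : normedModType R) (h : V * W) :
  `|h.1| <= `|h|.
Proof. by rewrite prod_normE le_max lexx. Qed.

Lemma prod_norm_snd (R : realType) (V W : normedModType R) (h : V * W) :
  `|h.2| <= `|h|.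
Proof. by rewrite prod_normE le_max lexx orbT. Qed.

(* [move:] rather than [generalize], since it abstracts the products up to
   conversion of their ring structures. *)
Ltac mx_abelian :=
  rewrite ?mulmxA;
  repeat match goal with |- context [?M *m ?P] => move: (M *m P) => ? end;
  apply/matrixP => ? ?; rewrite !mxE; ring.

Section Derivative.
Variables (R : realType) (p q n : nat).
Local Notation m := (p + q)%N.
Variables (A : 'M[R]_(m, n)) (b : 'cV[R]_m).
Hypothesis G_unit : ils_gram A \in unitmx.

Local Notation S := (Sigma R p q).
Local Notation G := (ils_gram A).
Local Notation Gi := (invmx G).
Local Notation x := (ils_sol A b).
Local Notation r := (ils_res A b).

(** The candidate derivative of x, from formal differentiation of the normal equations: G dx = dA^T
    S r - A^T S dA x + A^T S db. *)
Definition ils_dsol (dz : 'M[R]_(m, n) * 'cV[R]_m) : 'cV[R]_n :=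
  Gi *m dz.1^T *m S *m r - ils_W A *m dz.1 *m x + ils_W A *m dz.2.

Let trmxD1 (E E' : 'M[R]_(m, n)) : (E + E')^T = E^T + E'^T.
Proof. by rewrite linearD. Qed.

Let trmxZ1 a (E : 'M[R]_(m, n)) : (a *: E)^T = a *: E^T.
Proof. by rewrite linearZ. Qed.

Lemma ils_dsolP a (E E' : 'M[R]_(m, n)) (f f' : 'cV[R]_m) :
  ils_dsol (a *: E + E', a *: f + f') = a *: ils_dsol (E, f) + ils_dsol (E', f').
Proof.
rewrite /ils_dsol /= trmxD1 trmxZ1; move: (x) (r) => y z.
rewrite !mulmxDr !mulmxDl -!scalemxAr -!scalemxAl.
mx_abelian.
Qed.

Lemma ils_dsol_linear : linear ils_dsol.
Proof. by move=> a [E f] [E' f']; exact: ils_dsolP. Qed.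

Definition gram_incr (E : 'M[R]_(m, n)) : 'M[R]_n :=
  E^T *m S *m A + A^T *m S *m E + E^T *m S *m E.

Lemma ils_gramD (E : 'M[R]_(m, n)) : ils_gram (A + E) = G + gram_incr E.
Proof.
rewrite /ils_gram /gram_incr trmxD1 !mulmxDl !mulmxDr.
mx_abelian.
Qed.

Lemma ils_normal_equations (A' : 'M[R]_(m, n)) (b' : 'cV[R]_m) :
  ils_gram A' \in unitmx -> ils_gram A' *m ils_sol A' b' = A'^T *m S *m b'.
Proof.
rewrite /ils_sol /ils_W; move: (ils_gram A') => H H_unit.
by rewrite -!mulmxA (mulKVmx H_unit).
Qed.

(** After multiplication by G, subtracting the original normal equations from the perturbed ones
    cancels the first-order terms. The inverse of the perturbed Gram matrix never has to be
    expanded. *)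
Lemma ils_sol_increment (E : 'M[R]_(m, n)) (f : 'cV[R]_m) : ils_gram (A + E) \in unitmx ->
  let d := ils_sol (A + E) (b + f) - x in
  d - ils_dsol (E, f) =
    Gi *m (E^T *m S *m f - E^T *m S *m E *m x - gram_incr E *m d).
Proof.
move=> G'_unit d; apply: (can_inj (mulKmx G_unit)).
have Gx : G *m x = A^T *m S *m b.
  exact: ils_normal_equations.
have Gx' : (G + gram_incr E) *m (x + d) = (A + E)^T *m S *m (b + f).
  by rewrite -ils_gramD [x + d]addrC subrK; exact: ils_normal_equations.
rewrite (mulKVmx G_unit) mulmxBr.
have -> : G *m ils_dsol (E, f)
    = E^T *m S *m r - A^T *m S *m E *m x + A^T *m S *m f.
  rewrite /ils_dsol /ils_W /=; move: (x) (r) (G) G_unit => y z H H_unit.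
  by rewrite mulmxDr mulmxBr -!mulmxA !(mulKVmx H_unit).
have -> : G *m d = (A + E)^T *m S *m (b + f) - G *m x - gram_incr E *m (x + d).
  rewrite -Gx' mulmxDl [G *m (x + d)]mulmxDr addrAC addrK [_ + G *m d]addrC.
  by rewrite addrK.
rewrite Gx /ils_res trmxD1 /gram_incr; clearbody d; clear; move: (x) => y.
rewrite !mulmxDr !mulmxDl !mulmxN.
mx_abelian.
Qed.

Lemma ils_dsol_bounded :
  exists2 K, 0 <= K & forall h, `|ils_dsol h| <= K * `|h|.
Proof.
pose K := m%:R * (m%:R * (n%:R * `|Gi|) * `|S|) * `|r|
  + n%:R * (m%:R * `|ils_W A|) * `|x| + m%:R * `|ils_W A|.
exists K => [|h]; first by rewrite !addr_ge0 ?mulr_ge0.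
set t := `|h|.
have Et : `|h.1| <= t := prod_norm_fst h.
have ft : `|h.2| <= t := prod_norm_snd h.
have h1 : `|Gi *m h.1^T *m S *m r| <= m%:R * (m%:R * (n%:R * `|Gi| * t) * `|S|) * `|r|.
  by do 3!apply: mx_norm_prod_le => //; rewrite mx_norm_tr.
have h2 : `|ils_W A *m h.1 *m x| <= n%:R * (m%:R * `|ils_W A| * t) * `|x|.
  by do 2!apply: mx_norm_prod_le => //.
have h3 : `|ils_W A *m h.2| <= m%:R * `|ils_W A| * t.
  exact: mx_norm_prod_le.
have -> : K * t = m%:R * (m%:R * (n%:R * `|Gi| * t) * `|S|) * `|r|
  + n%:R * (m%:R * `|ils_W A| * t) * `|x| + m%:R * `|ils_W A| * t.
  by rewrite /K; ring.
rewrite /ils_dsol (le_trans (ler_normD _ _)) // lerD //.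
by rewrite (le_trans (ler_normB _ _)) // lerD.
Qed.

Lemma gram_incr_bounded : exists2 a, 0 <= a &
  forall E t, `|E| <= t -> t <= 1 -> `|gram_incr E| <= a * t.
Proof.
exists (m%:R * m%:R * `|S| * (`|A| + `|A| + 1)).
  by rewrite !mulr_ge0 // !addr_ge0.
move=> E t Et t1.
have h1 : `|E^T *m S *m A| <= m%:R * (m%:R * t * `|S|) * `|A|.
  by do 2!apply: mx_norm_prod_le => //; rewrite mx_norm_tr.
have h2 : `|A^T *m S *m E| <= m%:R * (m%:R * `|A| * `|S|) * t.
  by do 2!apply: mx_norm_prod_le => //; rewrite mx_norm_tr.
(* One of the two factors E is bounded by 1, which makes the quadratic term linear in t. *)
have h3 : `|E^T *m S *m E| <= m%:R * (m%:R * 1 * `|S|) * t.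
  by do 2!apply: mx_norm_prod_le => //; rewrite mx_norm_tr (le_trans Et).
have -> : m%:R * m%:R * `|S| * (`|A| + `|A| + 1) * t =
  m%:R * (m%:R * t * `|S|) * `|A| + m%:R * (m%:R * `|A| * `|S|) * t
  + m%:R * (m%:R * 1 * `|S|) * t by ring.
rewrite /gram_incr (le_trans (ler_normD _ _)) // lerD //.
by rewrite (le_trans (ler_normD _ _)) // lerD.
Qed.

Lemma ils_remainder_bounded : exists2 c, 0 <= c & forall E (f : 'cV[R]_m) t,
  `|E| <= t -> `|f| <= t ->
  `|E^T *m S *m f - E^T *m S *m E *m x| <= c * t ^+ 2.
Proof.
exists (m%:R * m%:R * `|S| * (1 + n%:R * `|x|)).
  by rewrite !mulr_ge0 // !addr_ge0 // mulr_ge0.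
move=> E f t Et ft.
have h1 : `|E^T *m S *m f| <= m%:R * (m%:R * t * `|S|) * t.
  by do 2!apply: mx_norm_prod_le => //; rewrite mx_norm_tr.
have h2 : `|E^T *m S *m E *m x| <= n%:R * (m%:R * (m%:R * t * `|S|) * t) * `|x|.
  by do 3!apply: mx_norm_prod_le => //; rewrite mx_norm_tr.
have -> : m%:R * m%:R * `|S| * (1 + n%:R * `|x|) * t ^+ 2 =
  m%:R * (m%:R * t * `|S|) * t + n%:R * (m%:R * (m%:R * t * `|S|) * t) * `|x|.
  by ring.
by rewrite (le_trans (ler_normB _ _)) // lerD.
Qed.

(** A row vector v killed by the perturbed Gram matrix is minus v times [gram_incr E] times the
    inverse of G, so its norm is at most half of itself and v = 0. *)
Lemma ils_gram_unit_near a E t : 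
  n%:R * (n%:R * (a * t)) * `|Gi| <= 1 / 2 -> `|gram_incr E| <= a * t ->
  ils_gram (A + E) \in unitmx.
Proof.
move=> small Ga; rewrite -row_free_unit; apply: inj_row_free => v.
rewrite ils_gramD mulmxDr => /eqP; rewrite addr_eq0 => /eqP vG.
have vE : v = - (v *m gram_incr E *m Gi) by rewrite -mulNmx -vG mulmxK.
have : `|v| <= `|v| / 2.
  rewrite {1}vE normrN.
  have : `|v *m gram_incr E *m Gi| <= n%:R * (n%:R * `|v| * (a * t)) * `|Gi|.
    by do 2!apply: mx_norm_prod_le => //.
  move/le_trans; apply.
  have -> : n%:R * (n%:R * `|v| * (a * t)) * `|Gi|
      = `|v| * (n%:R * (n%:R * (a * t)) * `|Gi|) by ring.
  by apply: ler_wpM2l => //; rewrite -[2^-1]mul1r.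
have := normr_ge0 v => v0 v2; apply/eqP; rewrite -normr_eq0 eq_le v0 andbT; lra.
Qed.

(** A bootstrap: the exact error formula contains the increment of x itself, which is first shown to
    be O(t) and then fed back to give O(t^2). *)
Lemma ils_sol_quadratic_error : exists d C, [/\ 0 < d, 0 <= C &
  forall h, `|h| <= d ->
  `|ils_sol (A + h.1) (b + h.2) - x - ils_dsol h| <= C * `|h| ^+ 2].
Proof.
have [K K0 dsolK] := ils_dsol_bounded.
have [a a0 incr_a] := gram_incr_bounded.
have [c c0 rem_c] := ils_remainder_bounded.
pose al := n%:R * `|Gi| * c; pose be := n%:R * `|Gi| * (n%:R * a).
have al0 : 0 <= al by rewrite !mulr_ge0.
have be0 : 0 <= be by rewrite !mulr_ge0.
have be1 : 0 < 2 * (be + 1) by rewrite mulr_gt0 // ltr_wpDl.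
(* The radius gives t <= 1 and be t <= 1/2. The constant comes from inserting |d| <= 2 (K + al) t
   into al t^2 + be t |d|. *)
exists (Num.min 1 (2 * (be + 1))^-1), (al + be * (2 * (K + al))).
split; first by rewrite lt_min ltr01 invr_gt0.
  by rewrite addr_ge0 // mulr_ge0 // mulr_ge0 // addr_ge0.
move=> h; set t := `|h|; rewrite le_min => /andP[t1 tbe].
have t0 : 0 <= t by exact: normr_ge0.
have be_t : be * t <= 1 / 2.
  have : t * (2 * (be + 1)) <= 1 by rewrite -ler_pdivlMr // div1r.
  by move: t0; nra.
have Et : `|h.1| <= t := prod_norm_fst h.
have ft : `|h.2| <= t := prod_norm_snd h.
have G'_unit : ils_gram (A + h.1) \in unitmx.
  apply: ils_gram_unit_near (incr_a _ _ Et t1).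
  by move: be_t; rewrite /be; apply: le_trans; rewrite le_eqVlt; apply/orP; left; apply/eqP; ring.
have := ils_sol_increment h.2 G'_unit; rewrite -surjective_pairing /=.
set d := ils_sol _ _ - x => dE.
have err : `|d - ils_dsol h| <= al * t ^+ 2 + be * t * `|d|.
  have -> : al * t ^+ 2 + be * t * `|d|
      = n%:R * `|Gi| * (c * t ^+ 2 + n%:R * (a * t) * `|d|) by rewrite /al /be; ring.
  rewrite dE; apply: mx_norm_prod_le => //.
  rewrite (le_trans (ler_normB _ _)) // lerD ?rem_c //.
  by apply: mx_norm_prod_le => //; exact: incr_a.
have d_le : `|d| <= K * t + al * t ^+ 2 + be * t * `|d|.
  have := ler_normD (ils_dsol h) (d - ils_dsol h); rewrite subrKC.
  have := dsolK h; rewrite -/t; lra.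
(* The term be t |d| is at most |d| / 2 and is absorbed on the left. *)
have d2 : `|d| <= 2 * (K + al) * t.
  have : be * t * `|d| <= 1 / 2 * `|d| by rewrite ler_wpM2r.
  have : al * t ^+ 2 <= al * t by rewrite expr2 ler_wpM2l // ler_piMl.
  lra.
rewrite (le_trans err) // mulrDl lerD2l.
have : be * t * `|d| <= be * t * (2 * (K + al) * t).
  by rewrite ler_wpM2l // mulr_ge0.
move/le_trans; apply; rewrite le_eqVlt; apply/orP; left; apply/eqP; ring.
Qed.

Lemma ils_map_diff (k : nat) (L : 'M[R]_(n, k)) dz :
  'd (ils_map L) (A, b) dz = L^T *m ils_dsol dz.
Proof.
have [K K0 dsolK] := ils_dsol_bounded.
have [d [C [d0 C0 solC]]] := ils_sol_quadratic_error.
apply: (congr1 (fun F => F dz) (diff_quadratic_error (f := ils_map L)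
  (df := fun h => L^T *m ils_dsol h)
  (K := n%:R * `|L| * K) (C := n%:R * `|L| * C) (d := d) _ _ _ _ _ _)) => //.
- by move=> s y z; rewrite ils_dsol_linear linearP.
- by rewrite !mulr_ge0.
- move=> h; rewrite -[leRHS]mulrA.
  by apply: mx_norm_prod_le; [rewrite mx_norm_tr|exact: dsolK].
- by rewrite !mulr_ge0.
- move=> h hd; rewrite /ils_map /= -!mulmxBr -[leRHS]mulrA.
  by apply: mx_norm_prod_le; [rewrite mx_norm_tr|exact: solC].
Qed.

End Derivative.

(** * The Kronecker form and componentwise perturbations *)

Section KroneckerForm.
Variables (R : realType) (p q n : nat).
Local Notation m := (p + q)%N.
Variables (A : 'M[R]_(m, n)) (b : 'cV[R]_m).

(** The entries of e follow the columns of [ils_VW]: those of A in the order of [vec], then those of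
    b. *)
Definition comp_scale (e : 'cV[R]_(n * m + m)) : 'M[R]_(m, n) * 'cV[R]_m :=
  (\matrix_(i, j) (A i j * e (lshift m (mxtens_index (j, i))) 0),
   \col_i (b i 0 * e (rshift (n * m) i) 0)).

Lemma sum_mxtens (V : nmodType) (F : 'I_(n * m) -> V) :
  \sum_k F k = \sum_(j < n) \sum_(i < m) F (mxtens_index (j, i)).
Proof.
rewrite pair_big /= (reindex (@mxtens_index n m)) /=.
  by apply: eq_bigr => -[].
by exists (@mxtens_unindex n m) => k _; rewrite ?mxtens_indexK ?mxtens_unindexK.
Qed.

Lemma ils_V_entry i j i' : ils_V A b i (mxtens_index (j, i')) =
  invmx (ils_gram A) i j * (Sigma R p q *m ils_res A b) i' 0
  - ils_sol A b j 0 * ils_W A i i'.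
Proof.
rewrite /ils_V !mxE !castmxE !cast_ord_id /=.
have -> : cast_ord (esym (muln1 n)) i = mxtens_index (i, ord0 : 'I_1).
  by apply: val_inj; rewrite /= muln1 addn0.
have -> : cast_ord (esym (mul1n n)) i = mxtens_index (ord0 : 'I_1, i).
  by apply: val_inj.
by rewrite !tensmxE !mxE.
Qed.

(** An instance of the rule that a Kronecker product of B and C sends vec E to vec (C E B^T),
    checked entrywise as a double sum. *)
Lemma ils_V_vec (E : 'M[R]_(m, n)) : ils_V A b *m vec E =
  invmx (ils_gram A) *m E^T *m Sigma R p q *m ils_res A b
  - ils_W A *m E *m ils_sol A b.
Proof.
apply/colP => i; rewrite [LHS]mxE sum_mxtens.
under eq_bigr do under eq_bigr do rewrite ils_V_entry vecE mulrBl.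
under eq_bigr do rewrite big_split /= sumrN.
rewrite big_split /= sumrN [RHS]mxE [X in _ = _ + X]mxE.
congr (_ - _).
  rewrite -!mulmxA [RHS]mxE; apply: eq_bigr => j _.
  rewrite [X in _ = _ * X]mxE mulr_sumr; apply: eq_bigr => i' _.
  by rewrite [E^T _ _]mxE -!mulrA; congr (_ * _); rewrite mulrC.
rewrite [RHS]mxE; apply: eq_bigr => j _.
rewrite [X in _ = X * _]mxE mulr_suml; apply: eq_bigr => i' _.
by ring.
Qed.

Lemma ils_VW_mul e : ils_VW A b *m e = ils_dsol A b (comp_scale e).
Proof.
rewrite -{1}[e]vsubmxK /ils_VW mul_row_col /ils_dsol -ils_V_vec.
congr (_ + _); rewrite -[LHS]mulmxA; congr (mulmx _ _); apply/colP => k.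
  case: (mxtens_indexP k) => j i.
  by rewrite mul_diag_mx mxE [_^T _ _]mxE !vecE !mxE.
by rewrite mul_diag_mx !mxE.
Qed.

End KroneckerForm.

(** * Perturbations of componentwise norm 1 *)

Section ComponentwiseNorm.
Variables (R : realType) (p q n : nat).
Local Notation m := (p + q)%N.
Variables (A : 'M[R]_(m, n)) (b : 'cV[R]_m).

Lemma comp_norm_sign (e : 'cV[R]_(n * m + m)) : A != 0 ->
  (forall k, `|e k 0| = 1) -> comp_norm (A, b) (comp_scale A b e) = 1%:E.
Proof.
move=> A0 e1; apply/eqP; rewrite eq_le; apply/andP; split.
  apply: ereal_inf_lbound; exists 1 => //=; split=> // [i j|i].
    by rewrite mxE normrM e1 mulr1 mul1r.
  by rewrite mxE normrM e1 mulr1 mul1r.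
(* A nonzero entry of A, left unchanged in absolute value, forces w >= 1. *)
apply: le_ereal_inf_tmp => _ [w /= [w0 wA _] <-]; rewrite lee_fin.
have [i [j Aij]] : exists i j, A i j != 0.
  apply: contrapT => h; case/negP: A0; apply/eqP/matrixP => i j; rewrite mxE.
  by apply/eqP; apply: contra_notT h => Aij; exists i, j.
have := wA i j; rewrite mxE normrM e1 mulr1 -{1}[`|A i j|]mul1r.
by rewrite ler_pM2r // normr_gt0.
Qed.

(** The vector e collects the quotients of perturbation by data. Where the data vanish so does the
    perturbation, and the convention a / 0 = 0 gives a valid entry. *)
Lemma comp_norm1_scale dz : comp_norm (A, b) dz = 1%:E ->
  exists2 e, dz = comp_scale A b e & forall k, `|e k 0| <= 1.
Proof.
move=> dz1.
have near1 eps : 0 < eps -> exists w, [/\ w < 1 + eps,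
    forall i j, `|dz.1 i j| <= w * `|A i j| &
    forall i, `|dz.2 i 0| <= w * `|b i 0|].
  move=> eps0.
  have : (comp_norm (A, b) dz < (1 + eps)%:E)%E by rewrite dz1 lte_fin ltrDl.
  move=> /ereal_inf_lt [_ [w /= [_ wA wb] <-]]; rewrite lte_fin => w1.
  by exists w.
(* The infimum only provides bounds w < 1 + eps, so w = 1 is reached by a limit, entry by entry. *)
have le1 (a c : R) :
    (forall eps, 0 < eps -> exists2 w, w < 1 + eps & c <= w * `|a|) -> c <= `|a|.
  move=> ca; apply/ler_addgt0Pr => eps eps0.
  have a1 : 0 < `|a| + 1 by rewrite ltr_wpDl.
  (* With eps / (|a| + 1) the excess over |a| stays below eps, also when a = 0. *)
  have [w w1 wa] := ca _ (divr_gt0 eps0 a1).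
  rewrite (le_trans wa) // (le_trans (ler_wpM2r _ (ltW w1))) //.
  by rewrite mulrDl mul1r lerD2l mulrAC ler_pdivrMr // ler_pM2l // lerDl.
have dA i j : `|dz.1 i j| <= `|A i j|.
  by apply: le1 => eps /near1 [w [w1 wA _]]; exists w.
have db i : `|dz.2 i 0| <= `|b i 0|.
  by apply: le1 => eps /near1 [w [w1 _ wb]]; exists w.
have divK (a c : R) : `|c| <= `|a| -> c = a * (c / a).
  have [->|a0 _] := eqVneq a 0; last by rewrite mulrC divfK.
  by rewrite normr0 normr_le0 mul0r => /eqP.
have div1 (a c : R) : `|c| <= `|a| -> `|c / a| <= 1.
  have [->|a0] := eqVneq a 0; first by rewrite invr0 mulr0 normr0.
  by rewrite normrM normfV ler_pdivrMr ?normr_gt0 // mul1r.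
exists (col_mx (vec (\matrix_(i, j) (dz.1 i j / A i j)))
               (\col_i (dz.2 i 0 / b i 0))) => [|k].
  rewrite [LHS]surjective_pairing; congr pair.
    by apply/matrixP => i j; rewrite mxE col_mxEu vecE mxE; exact: divK.
  by apply/colP => i; rewrite mxE col_mxEd mxE; exact: divK.
case: (split_ordP k) => k' ->.
  rewrite col_mxEu; case: (mxtens_indexP k') => j i.
  by rewrite vecE mxE div1.
by rewrite col_mxEd mxE div1.
Qed.
End ComponentwiseNorm.

(** * The condition number formula *)

Lemma posdefmx_unit (R : realType) (n : nat) (M : 'M[R]_n) :
  posdefmx M -> M \in unitmx.
Proof.
move=> [_ Mpos]; rewrite -row_free_unit; apply: inj_row_free => v vM.
apply/eqP; apply: contraT => v0; have := Mpos v^T.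
by rewrite trmx_eq0 trmxK vM mul0mx mxE ltxx => /(_ v0).
Qed.

Theorem theorem2 (R : realType) (p q n k : nat)
    (le_nm : (n <= p + q)%N) (k_gt0 : (0 < k)%N) (le_kn : (k <= n)%N)
    (A : 'M[R]_(p + q, n)) (b : 'cV[R]_(p + q)) (L : 'M[R]_(n, k))
    (Apos : posdefmx (A^T *m Sigma R p q *m A))
    (N : 'cV[R]_k -> R) (N_norm : is_norm N) :
  let kappa := cond_number N (ils_map L) (A, b) in
  [/\ is_max (cond_values N (ils_map L) (A, b)) kappa,
      is_max [set norm1 ((ils_VW A b)^T *m L *m u) |
               u in [set u : 'cV[R]_k | dual_norm N u = 1]] kappa
    & kappa = opnorm1 (dual_norm N) ((ils_VW A b)^T *m L)].
Proof.
move=> kappa.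
have G_unit : ils_gram A \in unitmx := posdefmx_unit Apos.
have A_neq0 : A != 0.
  have [v v0] := cV_nonzero R (leq_trans k_gt0 le_kn).
  apply/eqP => A0; have := Apos.2 v v0.
  by rewrite A0 !mulmx0 mul0mx mxE ltxx.
have [s [s1 s_max dual_max op_max]] :=
  max_at_sign_vector N_norm k_gt0 ((ils_VW A b)^T *m L).
have ND e : N ('d (ils_map L) (A, b) (comp_scale A b e))
    = N (((ils_VW A b)^T *m L)^T *m e).
  by rewrite (ils_map_diff b G_unit) -ils_VW_mul trmx_mul trmxK mulmxA.
(* The admissible perturbations only correspond to vectors inside the cube, but the maximum over the
   cube sits at a sign vector, whose perturbation has norm exactly 1 because A is nonzero. *)
have val_max : is_max (cond_values N (ils_map L) (A, b))
    (N (((ils_VW A b)^T *m L)^T *m s)).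
  split; first by exists (comp_scale A b s); [exact: comp_norm_sign|exact: ND].
  move=> _ [dz /= /comp_norm1_scale [e -> e1] <-].
  by rewrite ND s_max.
have kappaE : kappa = N (((ils_VW A b)^T *m L)^T *m s).
  apply/eqP; rewrite eq_le; apply/andP; split.
    apply: ge_sup; last exact: val_max.2.
    by exists (N (((ils_VW A b)^T *m L)^T *m s)); exact: val_max.1.
  by apply: ub_le_sup; [eexists; exact: val_max.2|exact: val_max.1].
by rewrite kappaE; split.
Qed.
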